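(* Let $k\ge 1$ be an integer, $x\in\{3,5\}$ and $\theta = 2\pi/(4k+x)$. For every finite point set $P$ in general position and every set of constraints $S$ on $P$, the constrained $\theta_{(4k+x)}$-graph of $P$ with respect to $S$ is a $\frac{\cos\left(\frac{\theta}{4}\right)}{\cos\left(\frac{\theta}{2}\right) - \sin\left(\frac{3\theta}{4}\right)}$-spanner of the visibility graph $\mathrm{Vis}(P,S)$.
   Context: $P$ is a finite set of points in the plane and $S$ is a set of line segments (called constraints), each joining two points of $P$, such that no two constraints intersect properly. Two points $u,v\in P$ can see each other if and only if the segment $uv$ does not properly intersect any constraint or $uv$ is itself a constraint. The visibility graph $\mathrm{Vis}(P,S)$ has vertex set $P$ and an edge $uv$ for every pair of points that can see each other, weighted by Euclidean length. Fix an integer $k\ge 1$, $x\in\{2,3,4,5\}$ and $\theta=2\pi/(4k+x)$. Around each point $u$, the $4k+x$ rays from $u$ with angle $\theta$ between consecutive rays define cones; they are oriented so that the bisector of one cone, $C_0^u$, is the vertical half-line above $u$, and the cones are numbered $C_0^u, C_1^u, \dots$ clockwise; all points use the same orientation. For every constraint $uv$ with $v\in C_i^u$, the line through that constraint splits $C_i^u$; the resulting pieces are the subcones of $C_i^u$ (if a constraint $uv$ splits a cone of $u$ into two subcones, $v$ is considered to lie in both; a cone not split is a single subcone). The constrained $\theta_{(4k+x)}$-graph has vertex set $P$ and, for each vertex $u$ and each subcone of each cone $C_i^u$, an edge between $u$ and the vertex $v$ of that subcone that can see $u$ and whose orthogonal projection onto the bisector of the full cone $C_i^u$ (not of the subcone)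 is closest to $u$ among all vertices of that subcone that can see $u$. Edges are weighted by Euclidean length. General position: no two points lie on a line parallel to one of the rays defining the cones, no two points lie on a line perpendicular to the bisector of a cone, and no three points are collinear. A subgraph $H$ of a weighted graph $G$ is a $t$-spanner of $G$ ($t\ge 1$) if for all vertices $u,v$, $d_H(u,v)\le t\cdot d_G(u,v)$, where $d$ denotes shortest-path distance. *)

(* Defs.v *)
From Stdlib Require Import Reals List.
Open Scope R_scope.

Definition point := (R * R)%type.
Definition vsub (p q : point) : point := (fst p - fst q, snd p - snd q).
Definition cross (a b : point) : R := fst a * snd b - snd a * fst b.
Definition dot (a b : point) : R := fst a * fst b + snd a * snd b.
Definition dist (p q : point) : R :=
  sqrt ((fst p - fst q) ^ 2 + (snd p - snd q) ^ 2).
Definition dir (alpha : R) : point := (cos alpha, sin alpha).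

Definition seg_point (a b : point) (s : R) : point :=
  (fst a + s * (fst b - fst a), snd a + s * (snd b - snd a)).
Definition properly_intersect (a b c d : point) : Prop :=
  exists s t, 0 < s < 1 /\ 0 < t < 1 /\ seg_point a b s = seg_point c d t.

Definition is_constraint (S : list (point * point)) (u v : point) : Prop :=
  In (u, v) S \/ In (v, u) S.
Definition same_seg (c1 c2 : point * point) : Prop :=
  c1 = c2 \/ (fst c1 = snd c2 /\ snd c1 = fst c2).
Definition valid_constraints (P : list point) (S : list (point * point)) : Prop :=
  (forall c, In c S -> In (fst c) P /\ In (snd c) P /\ fst c <> snd c) /\
  (forall c1 c2, In c1 S -> In c2 S -> ~ same_seg c1 c2 ->
     ~ properly_intersect (fst c1) (snd c1) (fst c2) (snd c2)).

Definition can_see (S : list (point * point)) (u v : point) : Prop :=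
  is_constraint S u v \/
  (forall c, In c S -> ~ properly_intersect u v (fst c) (snd c)).

Definition vis_edge (P : list point) (S : list (point * point)) (u v : point) : Prop :=
  In u P /\ In v P /\ u <> v /\ can_see S u v.

(** Cones: n cones of angle theta = 2 pi / n; cone 0 has the upward vertical
    as bisector, cones numbered clockwise. *)
Definition theta (n : nat) : R := 2 * PI / INR n.
Definition bis (n i : nat) : point := dir (PI / 2 - INR i * theta n).
Definition lbd (n i : nat) : point := dir (PI / 2 - INR i * theta n + theta n / 2).
Definition rbd (n i : nat) : point := dir (PI / 2 - INR i * theta n - theta n / 2).

Definition in_cone (n i : nat) (u v : point) : Prop :=
  cross (lbd n i) (vsub v u) <= 0 /\ 0 < cross (rbd n i) (vsub v u).

Definition sub_ray (S : list (point * point)) (n i : nat) (u r : point) : Prop :=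
  r = lbd n i \/ r = rbd n i \/
  (exists c, is_constraint S u c /\ in_cone n i u c /\ r = vsub c u).

Definition subcone (S : list (point * point)) (n i : nat) (u a b : point) : Prop :=
  sub_ray S n i u a /\ sub_ray S n i u b /\ cross a b < 0 /\
  (forall r, sub_ray S n i u r -> ~ (cross a r < 0 /\ cross r b < 0)).

(* w lies in the (closed on constraint rays) subcone (a,b) of C_i^u *)
Definition in_subcone (n i : nat) (u a b w : point) : Prop :=
  in_cone n i u w /\ cross a (vsub w u) <= 0 /\ 0 <= cross b (vsub w u).

Definition theta_choice (P : list point) (S : list (point * point)) (n : nat)
  (u v : point) : Prop :=
  exists i a b, (i < n)%nat /\ subcone S n i u a b /\ In v P /\
    in_subcone n i u a b v /\ can_see S u v /\
    (forall w, In w P -> in_subcone n i u a b w -> can_see S u w ->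
       dot (vsub v u) (bis n i) <= dot (vsub w u) (bis n i)).

Definition theta_edge (P : list point) (S : list (point * point)) (n : nat)
  (u v : point) : Prop :=
  In u P /\ In v P /\ (theta_choice P S n u v \/ theta_choice P S n v u).

Definition general_position (n : nat) (P : list point) : Prop :=
  (forall p q, In p P -> In q P -> p <> q -> forall j, (j < n)%nat ->
     cross (lbd n j) (vsub q p) <> 0 /\ dot (vsub q p) (bis n j) <> 0) /\
  (forall p q r, In p P -> In q P -> In r P -> p <> q -> q <> r -> p <> r ->
     cross (vsub q p) (vsub r p) <> 0).

Fixpoint chain (E : point -> point -> Prop) (u : point) (l : list point) : Prop :=
  match l with
  | nil => True
  | x :: l' => E u x /\ chain E x l'
  end.
Fixpoint wlen (u : point) (l : list point) : R :=
  match l with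
  | nil => 0
  | x :: l' => dist u x + wlen x l'
  end.
Definition is_shortest (E : point -> point -> Prop) (u v : point) (d : R) : Prop :=
  (exists l, chain E u l /\ last l u = v /\ wlen u l = d) /\
  (forall l, chain E u l -> last l u = v -> d <= wlen u l).

Definition t_spanner (P : list point) (EH EG : point -> point -> Prop) (t : R) : Prop :=
  (forall u v, EH u v -> EG u v) /\
  (forall u v, In u P -> In v P -> forall dG, is_shortest EG u v dG ->
     exists dH, is_shortest EH u v dH /\ dH <= t * dG).

(* Main.v *)
(** Write [c] for the claimed ratio.  By induction on [|uw|], every visible pair is
    joined in the theta-graph by a path of length at most [c |uw|].  As the number
    of cones is odd, one may exchange [u] and [w] so that [uw] makes an angle at
    most theta/4 with the bisector of the cone of [u] containing [w].  Let [v] be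
    the theta-neighbour of [u] in the subcone of [w], and [y] the point of [uw]
    with the same projection onto the bisector as [v].  The visible points of the
    triangle [uvw] all project beyond [v], which yields a path of visibility edges
    from [v] to [w] of length at most [|vy| + |yw|].  Since
    [|uv| + c |vy| <= c |uy|], with equality in the extreme position that
    determines [c], the induction hypothesis applies to the edges of that path. *)

From Stdlib Require Import Reals List.
From Stdlib Require Import ZArith Lra Lia Classical ListDec.
Require Import Defs.
Open Scope R_scope.

(** * Finite minimization *)

Lemma list_argmin (A : Type) (f : A -> R) (Q : A -> Prop) (l : list A) :
  (exists x, In x l /\ Q x) ->
  exists x, In x l /\ Q x /\ forall y, In y l -> Q y -> f x <= f y.
Proof.
  induction l as [|a l IH]; intros [x [Hx Qx]]; [destruct Hx|].
  destruct (classic (exists y, In y l /\ Q y)) as [Hl|Hl].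
  - destruct (IH Hl) as (m & Hm & Qm & Hmin).
    destruct (classic (Q a /\ f a < f m)) as [[Qa Ha]|Ha].
    + exists a; split; [now left|split; [exact Qa|]].
      intros y [<-|Hy] Qy; [lra|]. specialize (Hmin y Hy Qy); lra.
    + exists m; split; [now right|split; [exact Qm|]].
      intros y [<-|Hy] Qy; [|now apply Hmin].
      apply Rnot_lt_le; intro; apply Ha; now split.
  - destruct Hx as [<-|Hx]; [|exfalso; eauto].
    exists a; split; [now left|split; [exact Qx|]].
    intros y [<-|Hy] Qy; [lra|exfalso; eauto].
Qed.

(** A real measure is well-founded on a finite list: a counterexample of least measure contradicts
    the step. *)
Lemma list_real_induction (A : Type) (f : A -> R) (l : list A) (Q : A -> Prop) :
  (forall x, In x l -> (forall y, In y l -> f y < f x -> Q y) -> Q x) ->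
  forall x, In x l -> Q x.
Proof.
  intros Hstep x Hx. apply NNPP; intro HQ.
  destruct (list_argmin A f (fun y => ~ Q y) l) as (m & Hm & Qm & Hmin).
  { now exists x. }
  apply Qm, Hstep; [exact Hm|]. intros y Hy Hlt. apply NNPP; intro Qy.
  specialize (Hmin y Hy Qy); lra.
Qed.

Lemma last_cons_default (A : Type) (x d : A) (l : list A) : last (x :: l) d = last l x.
Proof.
  revert x d. induction l as [|y l IH]; intros x d; [reflexivity|].
  change (last (y :: l) d = last (y :: l) x). now rewrite !IH.
Qed.

(** * Plane vectors *)

Definition norm (a : point) : R := sqrt (fst a ^ 2 + snd a ^ 2).

Lemma norm_nonneg a : 0 <= norm a.
Proof. apply sqrt_pos. Qed.

Lemma norm_sqr a : norm a ^ 2 = fst a ^ 2 + snd a ^ 2.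
Proof. unfold norm. apply pow2_sqrt. nra. Qed.

Lemma norm_unique a r : 0 <= r -> r ^ 2 = fst a ^ 2 + snd a ^ 2 -> norm a = r.
Proof.
  intros Hr H. unfold norm. rewrite <- H. now apply sqrt_pow2.
Qed.

Lemma norm_triangle a b c :
  fst c = fst a + fst b -> snd c = snd a + snd b -> norm c <= norm a + norm b.
Proof.
  intros H1 H2.
  assert (Ha := norm_sqr a). assert (Hb := norm_sqr b). assert (Hc := norm_sqr c).
  assert (Ha0 := norm_nonneg a). assert (Hb0 := norm_nonneg b).
  assert (Hcs : fst a * fst b + snd a * snd b <= norm a * norm b).
  { apply Rsqr_incr_0_var; [|nra]. unfold Rsqr.
    replace (norm a * norm b * (norm a * norm b)) with (norm a ^ 2 * norm b ^ 2) by ring.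
    rewrite Ha, Hb. assert (Hsq := pow2_ge_0 (fst a * snd b - snd a * fst b)). nra. }
  apply Rsqr_incr_0_var; [|lra]. unfold Rsqr.
  rewrite H1, H2 in Hc. nra.
Qed.

Lemma norm_scal a b k :
  fst b = k * fst a -> snd b = k * snd a -> norm b = Rabs k * norm a.
Proof.
  intros H1 H2. apply norm_unique.
  - apply Rmult_le_pos; [apply Rabs_pos|apply norm_nonneg].
  - rewrite Rpow_mult_distr, pow2_abs, norm_sqr, H1, H2. ring.
Qed.

Lemma dist_norm p q : dist p q = norm (vsub p q).
Proof. reflexivity. Qed.

Lemma dist_nonneg p q : 0 <= dist p q.
Proof. rewrite dist_norm. apply norm_nonneg. Qed.

Lemma dist_sym p q : dist p q = dist q p.
Proof. unfold dist. f_equal. ring. Qed.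

Lemma dist_triangle p q r : dist p r <= dist p q + dist q r.
Proof. rewrite !dist_norm. apply norm_triangle; simpl; ring. Qed.

Lemma point_eq (p q : point) : fst p = fst q -> snd p = snd q -> p = q.
Proof. destruct p, q; simpl; now intros -> ->. Qed.

Lemma dist_pos p q : p <> q -> 0 < dist p q.
Proof.
  intro H. destruct (dist_nonneg p q) as [|H0]; [assumption|].
  exfalso; apply H. assert (Hs := norm_sqr (vsub p q)).
  rewrite <- dist_norm, <- H0 in Hs. simpl in Hs.
  assert (H1 := Rle_0_sqr (fst p - fst q)). assert (H2 := Rle_0_sqr (snd p - snd q)).
  unfold Rsqr in *. apply point_eq; apply Rminus_diag_uniq, Rsqr_0_uniq; unfold Rsqr; lra.
Qed.

Lemma cross_dot_frame e a b :
  (fst e ^ 2 + snd e ^ 2) * cross a b = dot e a * cross e b - cross e a * dot e b.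
Proof. unfold cross, dot. ring. Qed.

(** * Affine coordinates in the frame of a triangle *)

Definition comb (u v w : point) (b g : R) : point :=
  (fst u + b * (fst v - fst u) + g * (fst w - fst u),
   snd u + b * (snd v - snd u) + g * (snd w - snd u)).

(** Cramer's rule for the coefficients of [p - u] in the basis [v - u], [w - u]; with [coord2] it
    inverts [comb] when [u], [v], [w] are not collinear. *)
Definition coord1 (u v w p : point) : R :=
  cross (vsub p u) (vsub w u) / cross (vsub v u) (vsub w u).
Definition coord2 (u v w p : point) : R :=
  cross (vsub v u) (vsub p u) / cross (vsub v u) (vsub w u).

Lemma comb_coord u v w p :
  cross (vsub v u) (vsub w u) <> 0 -> p = comb u v w (coord1 u v w p) (coord2 u v w p).
Proof.
  intro H. unfold comb, coord1, coord2.
  apply point_eq; unfold cross, vsub in *; simpl in *; field; exact H.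
Qed.

Lemma coord1_comb u v w b g :
  cross (vsub v u) (vsub w u) <> 0 -> coord1 u v w (comb u v w b g) = b.
Proof. intro H. unfold coord1, comb, cross, vsub in *; simpl in *; field; exact H. Qed.

Lemma coord2_comb u v w b g :
  cross (vsub v u) (vsub w u) <> 0 -> coord2 u v w (comb u v w b g) = g.
Proof. intro H. unfold coord2, comb, cross, vsub in *; simpl in *; field; exact H. Qed.

Lemma comb_inj u v w b g b' g' :
  cross (vsub v u) (vsub w u) <> 0 -> comb u v w b g = comb u v w b' g' -> b = b' /\ g = g'.
Proof.
  intros H E. split.
  - rewrite <- (coord1_comb u v w b g H), E. now apply coord1_comb.
  - rewrite <- (coord2_comb u v w b g H), E. now apply coord2_comb.
Qed.

Lemma comb_swap u v w b g : comb u v w b g = comb u w v g b.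
Proof. unfold comb. apply point_eq; simpl; ring. Qed.

Lemma comb_comb_left u v w p b g b' g' :
  p = comb u v w b g -> comb u v p b' g' = comb u v w (b' + g' * b) (g' * g).
Proof. intros ->. unfold comb. apply point_eq; simpl; ring. Qed.

Lemma seg_comb u v w s b g b' g' :
  seg_point (comb u v w b g) (comb u v w b' g') s =
  comb u v w ((1 - s) * b + s * b') ((1 - s) * g + s * g').
Proof. unfold seg_point, comb. apply point_eq; simpl; ring. Qed.

Lemma dot_comb u v w b g e :
  dot (vsub (comb u v w b g) u) e = b * dot (vsub v u) e + g * dot (vsub w u) e.
Proof. unfold dot, vsub, comb; simpl; ring. Qed.

Lemma cross_comb u v w b g e :
  cross e (vsub (comb u v w b g) u) = b * cross e (vsub v u) + g * cross e (vsub w u).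
Proof. unfold cross, vsub, comb; simpl; ring. Qed.

Lemma cross_swap a b : cross a b = - cross b a.
Proof. unfold cross; ring. Qed.

Definition open_tri (u v w p : point) : Prop :=
  exists b g, 0 < b /\ 0 < g /\ b + g < 1 /\ p = comb u v w b g.

(** * Visibility *)

Lemma seg_point_flip a b s : seg_point a b s = seg_point b a (1 - s).
Proof. unfold seg_point. apply point_eq; simpl; ring. Qed.

Lemma properly_intersect_flip1 a b c d :
  properly_intersect a b c d -> properly_intersect b a c d.
Proof.
  intros (s & t & Hs & Ht & E). exists (1 - s), t.
  rewrite <- seg_point_flip. repeat split; (lra || assumption).
Qed.

Lemma properly_intersect_flip2 a b c d :
  properly_intersect a b c d -> properly_intersect a b d c.
Proof.
  intros (s & t & Hs & Ht & E). exists s, (1 - t).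
  rewrite <- seg_point_flip. repeat split; (lra || assumption).
Qed.

Lemma is_constraint_sym S u v : is_constraint S u v -> is_constraint S v u.
Proof. unfold is_constraint; tauto. Qed.

Lemma can_see_sym S u v : can_see S u v -> can_see S v u.
Proof.
  intros [H|H]; [left; now apply is_constraint_sym|right].
  intros c Hc Hi. apply (H c Hc). now apply properly_intersect_flip1.
Qed.

Lemma vis_edge_sym P S u v : vis_edge P S u v -> vis_edge P S v u.
Proof. intros (H1 & H2 & H3 & H4). repeat split; auto using can_see_sym. Qed.

Definition no_three_collinear (P : list point) : Prop :=
  forall p q r, In p P -> In q P -> In r P -> p <> q -> q <> r -> p <> r ->
    cross (vsub q p) (vsub r p) <> 0.

Section Visibility.
Variables (P : list point) (S : list (point * point)).
Hypothesis (Hvalid : valid_constraints P S) (Hcol : no_three_collinear P).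

Lemma constraint_endpoints c d : is_constraint S c d -> In c P /\ In d P /\ c <> d.
Proof.
  destruct Hvalid as [H _]. intros [Hc|Hc]; destruct (H _ Hc) as (H1 & H2 & H3);
    simpl in *; repeat split; auto.
Qed.

(** The two exceptions are genuine, since under [properly_intersect] a segment crosses itself. If
    [uv] is a constraint, any other crossing is excluded by the planarity of the constraints. *)
Lemma can_see_uncrossed u v c d :
  can_see S u v -> is_constraint S c d -> properly_intersect u v c d ->
  (c = u /\ d = v) \/ (c = v /\ d = u).
Proof.
  intros Hs Hc Hi. destruct Hvalid as [_ Hv].
  assert (Hno : forall a b, In (a, b) S -> (a = u /\ b = v) \/ (a = v /\ b = u) \/
     ~ properly_intersect u v a b).
  { intros a b Hab. destruct Hs as [[Hs|Hs]|Hs].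
    - destruct (classic (same_seg (u, v) (a, b))) as [[E|[E1 E2]]|N].
      + injection E; auto.
      + simpl in *; subst; auto.
      + right; right. exact (Hv _ _ Hs Hab N).
    - destruct (classic (same_seg (v, u) (a, b))) as [[E|[E1 E2]]|N].
      + injection E; auto.
      + simpl in *; subst; auto.
      + right; right. intro Hi'. apply (Hv _ _ Hs Hab N).
        now apply properly_intersect_flip1.
    - right; right. exact (Hs _ Hab). }
  destruct Hc as [Hc|Hc]; destruct (Hno _ _ Hc) as [[-> ->]|[[-> ->]|N]]; auto;
    exfalso; apply N; auto using properly_intersect_flip2.
Qed.

(** Contacts at an endpoint are invisible to [properly_intersect]; this excludes them, through the
    absence of collinear triples. *)
Lemma not_on_open_segment p q r s :
  In p P -> In q P -> In r P -> p <> q -> 0 < s < 1 -> r <> seg_point p q s.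
Proof.
  intros Hp Hq Hr Hpq Hs E.
  assert (Hd : fst q <> fst p \/ snd q <> snd p).
  { destruct (Req_dec (fst q) (fst p)); destruct (Req_dec (snd q) (snd p)); auto.
    exfalso; apply Hpq, point_eq; auto. }
  assert (Hrp : p <> r).
  { intros <-. rewrite E in Hd. apply (f_equal fst) in E as E1.
    apply (f_equal snd) in E as E2. unfold seg_point in *; simpl in *.
    destruct Hd as [Hd|Hd]; apply Hd; nra. }
  assert (Hrq : q <> r).
  { intros <-. apply (f_equal fst) in E as E1.
    apply (f_equal snd) in E as E2. unfold seg_point in *; simpl in *.
    destruct Hd as [Hd|Hd]; apply Hd; nra. }
  apply (Hcol p q r Hp Hq Hr Hpq Hrq Hrp). rewrite E.
  unfold cross, vsub, seg_point; simpl; ring.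
Qed.

(** No constraint at [u] enters the interior of the angle [vuw]. This is all that the visibility
    argument retains of [v] and [w] sharing a subcone. *)
Definition no_spoke (u v w : point) : Prop :=
  forall c b g, is_constraint S u c -> 0 < b -> 0 < g -> c <> comb u v w b g.

Definition wedge (u v w : point) : Prop :=
  In u P /\ In v P /\ In w P /\ cross (vsub v u) (vsub w u) <> 0 /\
  can_see S u v /\ can_see S u w /\ no_spoke u v w.

Lemma wedge_swap u v w : wedge u v w -> wedge u w v.
Proof.
  intros (H1 & H2 & H3 & H4 & H5 & H6 & H7). repeat split; auto.
  - rewrite cross_swap. lra.
  - intros c b g Hc Hb Hg E. apply (H7 c g b Hc Hg Hb). now rewrite comb_swap.
Qed.

Lemma wedge_neq u v w : wedge u v w -> u <> v /\ u <> w /\ v <> w.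
Proof.
  intros (_ & _ & _ & H & _). repeat split; intros <-; apply H; unfold cross, vsub; simpl; ring.
Qed.

(** Four cases, by whether the exit point is [u] and whether it is [d]: a proper crossing of the
    visible [uv], an endpoint on the open segment [uv], [u] inside the constraint, or a constraint
    at [u] entering the angle. *)
Lemma no_exit_first_side u v w c d s b g t z :
  wedge u v w -> is_constraint S c d -> 0 < s < 1 -> 0 < b -> 0 < g ->
  seg_point c d s = comb u v w b g ->
  s < t <= 1 -> 0 <= z < 1 -> seg_point c d t = comb u v w z 0 -> False.
Proof.
  intros W Hcd Hs Hb Hg Ex Ht Hz Ez.
  destruct (wedge_neq _ _ _ W) as (Nuv & Nuw & Nvw).
  destruct W as (Pu & Pv & Pw & HD & Suv & Suw & Hsp).
  destruct (constraint_endpoints _ _ Hcd) as (Pc & Pd & Ncd).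
  assert (Ez' : seg_point c d t = seg_point u v z).
  { rewrite Ez. unfold comb, seg_point. apply point_eq; simpl; ring. }
  (* [cd] is not the side [uv]: its point at parameter [s] lies off the line of that side. *)
  assert (Hg0 : forall q r, (q = u /\ r = v) \/ (q = v /\ r = u) ->
     seg_point q r s <> comb u v w b g).
  { intros q r Hqr E. assert (Hq : exists b', comb u v w b g = comb u v w b' 0).
    { rewrite <- E. destruct Hqr as [[-> ->]|[-> ->]].
      - exists s. unfold comb, seg_point; apply point_eq; simpl; ring.
      - exists (1 - s). unfold comb, seg_point; apply point_eq; simpl; ring. }
    destruct Hq as [b' Hq]. apply comb_inj in Hq; [lra|assumption]. }
  destruct (Rle_lt_or_eq_dec 0 z) as [Hz0|Hz0]; [lra| |];
    (destruct (Rle_lt_or_eq_dec t 1) as [Ht1|Ht1]; [lra| |]).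
  - assert (Hi : properly_intersect u v c d) by (exists z, t; repeat split; (lra || auto)).
    apply (Hg0 c d); [|assumption]. now apply can_see_uncrossed.
  - apply (not_on_open_segment u v d z); auto; try lra.
    rewrite <- Ez', Ht1. unfold seg_point; apply point_eq; simpl; ring.
  - apply (not_on_open_segment c d u t); auto; try lra.
    rewrite Ez', <- Hz0. unfold seg_point; apply point_eq; simpl; ring.
  - assert (d = u).
    { transitivity (seg_point c d t); [rewrite Ht1|rewrite Ez', <- Hz0];
        unfold seg_point; apply point_eq; simpl; ring. }
    (* With [d = u], the point at parameter [s] is [u + (1 - s)(c - u)], hence the division by
       [1 - s]. *)
    subst d. apply (Hsp c (b / (1 - s)) (g / (1 - s))).
    + now apply is_constraint_sym.
    + apply Rdiv_lt_0_compat; lra.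
    + apply Rdiv_lt_0_compat; lra.
    + apply (f_equal fst) in Ex as E1. apply (f_equal snd) in Ex as E2.
      unfold seg_point, comb in *; simpl in *.
      apply point_eq; simpl; apply Rmult_eq_reg_l with (1 - s); try lra;
        field_simplify; lra.
Qed.

(* Beyond its point inside the wedge, a constraint descending towards [u] can
   leave the triangle neither through [uv] and [uw], which are visible, nor at
   [u], so it ends inside. *)
Lemma constraint_ends_inside u v w c d s b g bd gd :
  wedge u v w -> is_constraint S c d -> 0 < s < 1 -> 0 < b -> 0 < g -> b + g <= 1 ->
  seg_point c d s = comb u v w b g -> d = comb u v w bd gd ->
  bd + gd <= b + g -> bd + gd < 1 -> 0 < bd /\ 0 < gd.
Proof.
  intros W Hcd Hs Hb Hg Hbg Ex Ed Hle Hlt.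
  (* Reparametrises the rest of the constraint, from the inner point at [t = 0] to [d] at
     [t = 1]. *)
  assert (Hmid : forall t, seg_point c d (s + t * (1 - s)) =
     comb u v w ((1 - t) * b + t * bd) ((1 - t) * g + t * gd)).
  { intro t. rewrite <- seg_comb, <- Ex, <- Ed.
    unfold seg_point; apply point_eq; simpl; ring. }
  assert (Hex : forall t, 0 < t <= 1 -> (1 - t) * g + t * gd = 0 ->
     0 <= (1 - t) * b + t * bd -> False).
  { intros t Ht E Hz. specialize (Hmid t). rewrite E in Hmid.
    apply (no_exit_first_side u v w c d s b g (s + t * (1 - s)) ((1 - t) * b + t * bd));
      auto; try split; nra. }
  assert (Hex' : forall t, 0 < t <= 1 -> (1 - t) * b + t * bd = 0 ->
     0 <= (1 - t) * g + t * gd -> False).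
  { intros t Ht E Hz. specialize (Hmid t). rewrite E, comb_swap in Hmid.
    apply (no_exit_first_side u w v c d s g b (s + t * (1 - s)) ((1 - t) * g + t * gd));
      auto using wedge_swap; try (rewrite comb_swap; assumption); try split; nra. }
  assert (Htb : bd <= 0 -> 0 < b / (b - bd) <= 1 /\
     (1 - b / (b - bd)) * b + b / (b - bd) * bd = 0).
  { intro H. split; [split|field; lra].
    - apply Rdiv_lt_0_compat; lra.
    - apply Rmult_le_reg_r with (b - bd); [lra|]. field_simplify; lra. }
  assert (Htg : gd <= 0 -> 0 < g / (g - gd) <= 1 /\
     (1 - g / (g - gd)) * g + g / (g - gd) * gd = 0).
  { intro H. split; [split|field; lra].
    - apply Rdiv_lt_0_compat; lra.
    - apply Rmult_le_reg_r with (g - gd); [lra|]. field_simplify; lra. }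
  split; apply Rnot_le_lt; intro H.
  (* Where the first coordinate vanishes, either the second is still nonnegative and the exit is
     through [uw], or the second vanished no later and the exit is through [uv]. *)
  - destruct (Htb H) as [H1 E1].
    destruct (Rle_lt_dec 0 ((1 - b / (b - bd)) * g + b / (b - bd) * gd)) as [Hc|Hc];
      [exact (Hex' _ H1 E1 Hc)|].
    assert (Hgd : gd <= 0) by nra. destruct (Htg Hgd) as [H2 E2].
    apply (Hex _ H2 E2). set (tb := b / (b - bd)) in *. set (tg := g / (g - gd)) in *.
    assert (tg <= tb) by nra. nra.
  - destruct (Htg H) as [H1 E1].
    destruct (Rle_lt_dec 0 ((1 - g / (g - gd)) * b + g / (g - gd) * bd)) as [Hc|Hc];
      [exact (Hex _ H1 E1 Hc)|].
    assert (Hbd : bd <= 0) by nra. destruct (Htb Hbd) as [H2 E2].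
    apply (Hex' _ H2 E2). set (tb := b / (b - bd)) in *. set (tg := g / (g - gd)) in *.
    assert (tb <= tg) by nra. nra.
Qed.

(** Take [p] in the triangle with [coord1 + coord2] least, that is, nearest to [u] measured across
    lines parallel to [vw]. A constraint crossing [up] has an endpoint no farther than the crossing;
    it would lie inside the triangle and beat [p]. *)
Lemma visible_point_in_triangle u v w :
  wedge u v w -> (exists p, In p P /\ open_tri u v w p) ->
  exists p, In p P /\ open_tri u v w p /\ can_see S u p.
Proof.
  intros W Hex.
  destruct (list_argmin _ (fun p => coord1 u v w p + coord2 u v w p) (open_tri u v w) P Hex)
    as (p & Pp & (b & g & Hb & Hg & Hbg & Ep) & Hmin).
  assert (HD : cross (vsub v u) (vsub w u) <> 0) by apply W.
  exists p. split; [assumption|split; [now exists b, g|]].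
  assert (Hno : forall c d s, is_constraint S c d -> 0 < s < 1 ->
     forall r, 0 < r < 1 -> seg_point u p r = seg_point c d s ->
     r * (b + g) < coord1 u v w d + coord2 u v w d).
  { intros c d s Hcd Hs r Hr E. apply Rnot_le_lt; intro Hle.
    destruct (constraint_endpoints _ _ Hcd) as (Pc & Pd & Ncd).
    assert (Ed := comb_coord u v w d HD).
    assert (Ex : seg_point c d s = comb u v w (r * b) (r * g)).
    { rewrite <- E, Ep. unfold seg_point, comb; apply point_eq; simpl; ring. }
    destruct (constraint_ends_inside u v w c d s (r * b) (r * g)
       (coord1 u v w d) (coord2 u v w d)) as [H1 H2]; auto; try nra.
    assert (Hd : open_tri u v w d).
    { exists (coord1 u v w d), (coord2 u v w d). repeat split; auto; nra. }
    specialize (Hmin d Pd Hd). rewrite Ep, coord1_comb, coord2_comb in Hmin; auto. nra. }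
  right. intros [c d] Hc (r & s & Hr & Hs & E). simpl in *.
  assert (H1 : is_constraint S c d) by now left.
  assert (H2 := Hno c d s H1 Hs r Hr E).
  assert (E' := E). rewrite (seg_point_flip c d) in E'.
  assert (Hs' : 0 < 1 - s < 1) by lra.
  assert (H3 := Hno d c (1 - s) (is_constraint_sym _ _ _ H1) Hs' r Hr E').
  assert (Hm : seg_point u p r = comb u v w (r * b) (r * g)).
  { rewrite Ep. unfold seg_point, comb; apply point_eq; simpl; ring. }
  (* Both ends lie strictly beyond the crossing in [coord1 + coord2], yet the crossing is a convex
     combination of them. *)
  rewrite E, (comb_coord u v w c HD), (comb_coord u v w d HD), seg_comb in Hm.
  apply comb_inj in Hm; [|assumption]. destruct Hm as [M1 M2]. nra.
Qed.

(** A constraint crossing [vw] either has an endpoint strictly on the side of [u], which then falls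
    in the empty triangle, or runs along the line [vw] and, by general position, is [vw] itself. *)
Lemma empty_triangle_visible u v w :
  wedge u v w -> (forall p, In p P -> can_see S u p -> ~ open_tri u v w p) ->
  can_see S v w.
Proof.
  intros W Hemp.
  assert (HD : cross (vsub v u) (vsub w u) <> 0) by apply W.
  destruct (wedge_neq _ _ _ W) as (Nuv & Nuw & Nvw).
  assert (Pv : In v P) by apply W. assert (Pw : In w P) by apply W.
  assert (Hempty : forall p, In p P -> ~ open_tri u v w p).
  { intros p Pp Hp. destruct (visible_point_in_triangle u v w W) as (q & Pq & Hq & Sq).
    - now exists p.
    - exact (Hemp q Pq Sq Hq). }
  assert (Hno : forall c d s, is_constraint S c d -> 0 < s < 1 ->
     forall r, 0 < r < 1 -> seg_point v w r = seg_point c d s ->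
     1 <= coord1 u v w d + coord2 u v w d).
  { intros c d s Hcd Hs r Hr E. apply Rnot_lt_le; intro Hlt.
    destruct (constraint_endpoints _ _ Hcd) as (Pc & Pd & Ncd).
    assert (Ed := comb_coord u v w d HD).
    assert (Ex : seg_point c d s = comb u v w (1 - r) r).
    { rewrite <- E. unfold seg_point, comb; apply point_eq; simpl; ring. }
    destruct (constraint_ends_inside u v w c d s (1 - r) r
       (coord1 u v w d) (coord2 u v w d)) as [H1 H2]; auto; try lra.
    apply (Hempty d Pd). exists (coord1 u v w d), (coord2 u v w d). auto. }
  destruct (classic (is_constraint S v w)) as [|Hvw]; [now left|right].
  intros [c d] Hc (r & s & Hr & Hs & E). simpl in *.
  assert (H1 : is_constraint S c d) by now left.
  assert (H2 := Hno c d s H1 Hs r Hr E).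
  assert (E' := E). rewrite (seg_point_flip c d) in E'.
  assert (Hs' : 0 < 1 - s < 1) by lra.
  assert (H3 := Hno d c (1 - s) (is_constraint_sym _ _ _ H1) Hs' r Hr E').
  assert (Hm : seg_point v w r = comb u v w (1 - r) r).
  { unfold seg_point, comb; apply point_eq; simpl; ring. }
  rewrite E, (comb_coord u v w c HD), (comb_coord u v w d HD), seg_comb in Hm.
  apply comb_inj in Hm; [|assumption]. destruct Hm as [M1 M2].
  assert (Hc1 : coord1 u v w c + coord2 u v w c = 1) by nra.
  assert (Hd1 : coord1 u v w d + coord2 u v w d = 1) by nra.
  assert (Hline : forall q, In q P -> coord1 u v w q + coord2 u v w q = 1 -> q = v \/ q = w).
  { intros q Pq Hq. apply NNPP; intro N. apply not_or_and in N. destruct N as [N1 N2].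
    apply (Hcol v w q); auto. rewrite (comb_coord u v w q HD).
    replace (coord1 u v w q) with (1 - coord2 u v w q) by lra.
    unfold cross, vsub, comb; simpl; ring. }
  destruct (constraint_endpoints _ _ H1) as (Pc & Pd & Ncd).
  destruct (Hline c Pc Hc1) as [->| ->], (Hline d Pd Hd1) as [->| ->];
    auto using is_constraint_sym.
Qed.

(** * Visibility paths below a wedge *)

(** The equation for [s'] makes the segment from the new vertex to its point of [uw] parallel to the
    one from [v], and [b] times as long. The step from [v] to the new vertex splits into the
    remaining fraction [1 - b] of that segment and a move along [uw]. *)
Lemma detour_le u v w b g s s' :
  0 <= b <= 1 -> 0 <= s -> s <= s' <= 1 -> s' = b * s + g ->
  dist v (comb u v w b g) +
    (dist (comb u v w b g) (seg_point u w s') + dist (seg_point u w s') w) <=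
  dist v (seg_point u w s) + dist (seg_point u w s) w.
Proof.
  intros Hb Hs Hs' E.
  assert (Hw : forall a, a <= 1 -> dist (seg_point u w a) w = (1 - a) * dist w u).
  { intros a Ha. rewrite !dist_norm.
    rewrite (norm_scal (vsub w u) (vsub (seg_point u w a) w) (a - 1));
      [|unfold seg_point; simpl; ring..].
    rewrite Rabs_left1; [ring|lra]. }
  assert (H1 : dist (comb u v w b g) (seg_point u w s') = b * dist v (seg_point u w s)).
  { rewrite !dist_norm.
    rewrite (norm_scal (vsub v (seg_point u w s)) _ b);
      [|unfold seg_point, comb; simpl; subst s'; ring..].
    rewrite Rabs_right; lra. }
  assert (H2 : dist v (comb u v w b g) <=
     (1 - b) * dist v (seg_point u w s) + (s' - s) * dist w u).
  { rewrite !dist_norm.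
    set (a1 := ((1 - b) * fst (vsub v (seg_point u w s)),
                (1 - b) * snd (vsub v (seg_point u w s))) : point).
    set (a2 := ((s - s') * fst (vsub w u), (s - s') * snd (vsub w u)) : point).
    apply Rle_trans with (norm a1 + norm a2).
    - apply norm_triangle; unfold a1, a2, seg_point, comb; simpl; subst s'; ring.
    - rewrite (norm_scal (vsub v (seg_point u w s)) a1 (1 - b)) by reflexivity.
      rewrite (norm_scal (vsub w u) a2 (s - s')) by reflexivity.
      rewrite (Rabs_right (1 - b)), (Rabs_left1 (s - s')); lra. }
  rewrite (Hw s), (Hw s'), H1; lra.
Qed.

(* The next vertex after [v] is the visible point of the open triangle [uvw]
   lowest in direction [e]; the triangle it spans with [u] and [v] then contains
   no visible point. *)
Lemma visibility_path_below u w e :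
  forall v, In v P ->
  wedge u v w ->
  0 < dot (vsub v u) e <= dot (vsub w u) e ->
  (forall p, In p P -> can_see S u p -> open_tri u v w p ->
     dot (vsub v u) e <= dot (vsub p u) e) ->
  exists l, chain (vis_edge P S) v l /\ last l v = w /\
    wlen v l <= dist v (seg_point u w (dot (vsub v u) e / dot (vsub w u) e)) +
                dist (seg_point u w (dot (vsub v u) e / dot (vsub w u) e)) w.
Proof.
  (* The measure depends only on the direction of [v - u] and vanishes in the direction of [w - u];
     it drops as successive vertices turn towards [uw]. *)
  intros v Pv. pattern v. revert v Pv. apply (list_real_induction point
    (fun v => Rabs (cross (vsub w u) (vsub v u)) / dot (vsub v u) e) P).
  intros v Pv IH W HL Hlow.
  destruct (wedge_neq _ _ _ W) as (Nuv & Nuw & Nvw).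
  destruct W as (Pu & _ & Pw & HD & Suv & Suw & Hsp).
  assert (W : wedge u v w) by (repeat split; assumption).
  destruct (classic (exists p, In p P /\ (open_tri u v w p /\ can_see S u p))) as [Hex|Hno].
  2:{ exists (w :: nil). simpl. repeat split; auto.
      - apply (empty_triangle_visible u v w W). intros p Pp Sp Tp. apply Hno; now exists p.
      - rewrite Rplus_0_r. apply dist_triangle. }
  destruct (list_argmin point (fun p => dot (vsub p u) e)
     (fun p => open_tri u v w p /\ can_see S u p) P Hex)
    as (p & Pp & [Tp Sp] & Hmin).
  assert (Hvp := Hlow p Pp Sp Tp).
  destruct Tp as (b & g & Hb & Hg & Hbg & Ep).
  set (Lv := dot (vsub v u) e) in *. set (Lw := dot (vsub w u) e) in *.
  assert (HLp : dot (vsub p u) e = b * Lv + g * Lw).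
  { rewrite Ep. apply dot_comb. }
  assert (HDp : cross (vsub p u) (vsub w u) = b * cross (vsub v u) (vsub w u)).
  { rewrite Ep. unfold cross, vsub, comb; simpl; ring. }
  assert (HDvp : cross (vsub v u) (vsub p u) = g * cross (vsub v u) (vsub w u)).
  { rewrite Ep. unfold cross, vsub, comb; simpl; ring. }
  assert (Wp : wedge u p w).
  { repeat split; auto.
    - rewrite HDp. apply Rmult_integral_contrapositive_currified; lra.
    - intros c b' g' Hc Hb' Hg' E. apply (Hsp c (b' * b) (b' * g + g') Hc); [nra..|].
      rewrite E, Ep. unfold comb; apply point_eq; simpl; ring. }
  assert (Wvp : wedge u v p).
  { repeat split; auto.
    - rewrite HDvp. apply Rmult_integral_contrapositive_currified; lra.
    - intros c b' g' Hc Hb' Hg' E. apply (Hsp c (b' + g' * b) (g' * g) Hc); [nra..|].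
      rewrite E. now apply comb_comb_left. }
  assert (Svp : can_see S v p).
  { apply (empty_triangle_visible u v p Wvp).
    intros q Pq Sq (b' & g' & Hb' & Hg' & Hbg' & Eq).
    (* A point of the open triangle [uvp] projects strictly below [p], because [v] projects no
       higher than [p] and the coefficients sum to less than 1. *)
    assert (Hq : dot (vsub p u) e <= dot (vsub q u) e).
    { apply Hmin; auto. split; auto.
      exists (b' + g' * b), (g' * g). repeat split; [nra..|].
      rewrite Eq. now apply comb_comb_left. }
    rewrite Eq, dot_comb in Hq. fold Lv in Hq. nra. }
  destruct (wedge_neq _ _ _ Wvp) as (_ & _ & Nvp).
  destruct (IH p Pp) as (l & Hl & Hlast & Hlen); auto.
  - assert (HcD : Rabs (cross (vsub w u) (vsub p u)) = b * Rabs (cross (vsub w u) (vsub v u))).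
    { rewrite cross_swap, HDp, (cross_swap (vsub w u)), !Rabs_Ropp, Rabs_mult.
      rewrite (Rabs_right b); lra. }
    assert (HcP : 0 < Rabs (cross (vsub w u) (vsub v u))).
    { apply Rabs_pos_lt. rewrite cross_swap. lra. }
    rewrite HcD. set (K := Rabs (cross (vsub w u) (vsub v u))) in *.
    fold Lv. rewrite HLp.
    assert (0 < b * Lv + g * Lw) by nra. assert (0 < K * (g * Lw)) by
      (apply Rmult_lt_0_compat; [assumption|apply Rmult_lt_0_compat; lra]).
    apply Rmult_lt_reg_r with (Lv * (b * Lv + g * Lw)); [nra|].
    field_simplify; lra.
  - fold Lw. rewrite HLp. nra.
  - intros q Pq Sq (b' & g' & Hb' & Hg' & Hbg' & Eq). apply Hmin; auto. split; auto.
    exists (b' * b), (b' * g + g'). repeat split; [nra..|].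
    rewrite Eq, Ep. unfold comb; apply point_eq; simpl; ring.
  - exists (p :: l). repeat split; auto.
    + now rewrite last_cons_default.
    + cbn [wlen]. eapply Rle_trans; [apply Rplus_le_compat_l, Hlen|].
      fold Lw. rewrite HLp, Ep. apply detour_le; try split; try lra.
      * apply Rlt_le, Rdiv_lt_0_compat; lra.
      * apply Rmult_le_reg_r with Lw; [lra|]. field_simplify; nra.
      * apply Rmult_le_reg_r with Lw; [lra|]. field_simplify; nra.
      * field. lra.
Qed.

End Visibility.

(** * Paths and shortest paths *)

Definition linked (E : point -> point -> Prop) (u v : point) (d : R) : Prop :=
  exists l, chain E u l /\ last l u = v /\ wlen u l <= d.

Lemma chain_app E u l1 l2 :
  chain E u (l1 ++ l2) <-> chain E u l1 /\ chain E (last l1 u) l2.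
Proof.
  revert u. induction l1 as [|a l1 IH]; intro u; [simpl; tauto|].
  rewrite last_cons_default. cbn [app chain]. rewrite IH. tauto.
Qed.

Lemma last_app (u : point) l1 l2 : last (l1 ++ l2) u = last l2 (last l1 u).
Proof.
  revert u. induction l1 as [|a l1 IH]; intro u; [reflexivity|].
  rewrite <- app_comm_cons, !last_cons_default. apply IH.
Qed.

Lemma wlen_app u l1 l2 : wlen u (l1 ++ l2) = wlen u l1 + wlen (last l1 u) l2.
Proof.
  revert u. induction l1 as [|a l1 IH]; intro u; [simpl; ring|].
  rewrite last_cons_default. cbn [app wlen]. rewrite IH. ring.
Qed.

Lemma wlen_nonneg u l : 0 <= wlen u l.
Proof.
  revert u. induction l as [|a l IH]; intro u; simpl; [lra|].
  specialize (IH a). assert (H := dist_nonneg u a). lra.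
Qed.

Lemma linked_refl E u : linked E u u 0.
Proof. exists nil; simpl; repeat split; lra. Qed.

Lemma linked_edge (E : point -> point -> Prop) u v : E u v -> linked E u v (dist u v).
Proof. intro H. exists (v :: nil); simpl; repeat split; auto; lra. Qed.

Lemma linked_trans E u v w d1 d2 :
  linked E u v d1 -> linked E v w d2 -> linked E u w (d1 + d2).
Proof.
  intros (l1 & H1 & <- & W1) (l2 & H2 & <- & W2). exists (l1 ++ l2).
  rewrite chain_app, last_app, wlen_app. repeat split; auto; lra.
Qed.

Lemma linked_le E u v d1 d2 : linked E u v d1 -> d1 <= d2 -> linked E u v d2.
Proof. intros (l & H1 & H2 & H3) H. exists l. repeat split; auto; lra. Qed.

Lemma linked_sym (E : point -> point -> Prop) u v d :
  (forall a b, E a b -> E b a) -> linked E u v d -> linked E v u d.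
Proof.
  intros Hs (l & Hc & Hl & Hw). apply linked_le with (wlen u l); [|assumption].
  subst v. clear Hw. revert u Hc. induction l as [|a l IH]; intros u Hc.
  - apply linked_refl.
  - destruct Hc as [Hua Hc]. rewrite last_cons_default. cbn [wlen].
    rewrite Rplus_comm, dist_sym. apply linked_trans with a; auto using linked_edge.
Qed.

(** The cap [D] lets the hypothesis come from an induction that covers only short edges: no edge of
    a chain is longer than the chain. *)
Lemma chain_dilation (E F : point -> point -> Prop) c D :
  (forall a b, E a b -> dist a b <= D -> linked F a b (c * dist a b)) ->
  forall l u, chain E u l -> wlen u l <= D -> linked F u (last l u) (c * wlen u l).
Proof.
  intro H. induction l as [|a l IH]; intros u Hc Hw.
  - apply linked_le with 0; [apply linked_refl|simpl; lra].
  - destruct Hc as [Hua Hc]. rewrite last_cons_default. cbn [wlen] in *.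
    assert (H1 := wlen_nonneg a l). assert (H2 := dist_nonneg u a).
    rewrite Rmult_plus_distr_l. apply linked_trans with a.
    + apply H; auto; lra.
    + apply IH; auto; lra.
Qed.

(** Deleting the closed walk between two visits of a vertex does not lengthen the chain. This leaves
    finitely many candidates for a shortest path. *)
Lemma chain_shortcut E u l :
  chain E u l -> exists l', NoDup l' /\ incl l' l /\ chain E u l' /\
    last l' u = last l u /\ wlen u l' <= wlen u l.
Proof.
  remember (length l) as N eqn:HN. revert l HN.
  induction N as [N IH] using (well_founded_induction lt_wf). intros l HN Hc.
  destruct (classic (NoDup l)) as [Hd|Hd].
  - exists l. repeat split; auto using incl_refl; lra.
  - apply (not_NoDup (fun p q : point => classic (p = q))) in Hd.
    destruct Hd as (a & l1 & l2 & l3 & El).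
    assert (E1 : l = (l1 ++ a :: l2) ++ a :: l3) by now rewrite El, <- app_assoc.
    destruct (IH (length (l1 ++ a :: l3))) with (l := l1 ++ a :: l3)
      as (l' & H1 & H2 & H3 & H4 & H5); auto.
    + rewrite HN, E1, !length_app. simpl. lia.
    + rewrite E1, !chain_app in Hc. apply chain_app. destruct Hc as [[Hc1 [Hc2 _]] [_ Hc3]].
      now repeat split.
    + exists l'. split; [assumption|split; [|split; [assumption|split]]].
      * intros x Hx. apply H2 in Hx. rewrite El. rewrite !in_app_iff in *.
        simpl in *. rewrite in_app_iff. simpl. tauto.
      * rewrite H4, E1, !last_app, !last_cons_default. reflexivity.
      * apply Rle_trans with (1 := H5). rewrite El, !wlen_app. cbn [wlen].
        rewrite !wlen_app. cbn [wlen].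
        assert (Ha := wlen_nonneg a l2). assert (Hb := dist_nonneg (last l2 a) a). lra.
Qed.

Fixpoint words (n : nat) (P : list point) : list (list point) :=
  match n with
  | O => nil :: nil
  | Datatypes.S n' => nil :: flat_map (fun x => map (cons x) (words n' P)) P
  end.

Lemma in_words n P l : (length l <= n)%nat -> incl l P -> In l (words n P).
Proof.
  revert l. induction n as [|n IH]; intros [|a l] Hn Hi; simpl in *; auto; try lia.
  right. apply in_flat_map. exists a. split; [apply Hi; now left|].
  apply in_map, IH; [lia|]. intros x Hx. apply Hi. now right.
Qed.

(** [is_shortest] asks for an attained minimum. After shortcuts only the words over [P] of length at
    most [length P] compete, and they form a finite list. *)
Lemma shortest_exists (E : point -> point -> Prop) (P : list point) u v d :
  (forall a b, E a b -> In b P) -> linked E u v d ->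
  exists d', is_shortest E u v d' /\ d' <= d.
Proof.
  intros HE (l & Hc & Hl & Hw).
  assert (Hin : forall m a, chain E a m -> incl m P).
  { induction m as [|b m IH]; intros a Hm x Hx; [destruct Hx|].
    destruct Hm as [Hab Hm], Hx as [<-|Hx]; [now apply HE in Hab|now apply (IH b)]. }
  assert (Hred : forall m, chain E u m -> exists m', In m' (words (length P) P) /\
     chain E u m' /\ last m' u = last m u /\ wlen u m' <= wlen u m).
  { intros m Hm. destruct (chain_shortcut E u m Hm) as (m' & H1 & H2 & H3 & H4 & H5).
    exists m'. repeat split; auto. apply in_words; eauto using NoDup_incl_length. }
  destruct (Hred l Hc) as (l' & H1 & H2 & H3 & H4).
  destruct (list_argmin _ (wlen u) (fun m => chain E u m /\ last m u = v)
     (words (length P) P)) as (m & M1 & [M2 M3] & M4).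
  { exists l'. repeat split; auto. congruence. }
  assert (Hmin : forall k, chain E u k -> last k u = v -> wlen u m <= wlen u k).
  { intros k Hk Hkv. destruct (Hred k Hk) as (k' & K1 & K2 & K3 & K4).
    apply Rle_trans with (2 := K4), M4; auto. split; congruence. }
  exists (wlen u m). split; [split; [now exists m|exact Hmin]|].
  apply Rle_trans with (wlen u l); auto.
Qed.

(** * The detour inequality *)

Definition ratio (th : R) : R := cos (th / 4) / (cos (th / 2) - sin (3 * th / 4)).

Definition polar (r t : R) : point := (r * cos t, r * sin t).

Lemma norm_polar r t : 0 <= r -> norm (polar r t) = r.
Proof.
  intro Hr. apply norm_unique; [assumption|]. unfold polar; simpl fst; simpl snd.
  assert (H := sin2_cos2 t). unfold Rsqr in H. nra.
Qed.

Lemma dot_polar_dir r t s : dot (polar r t) (dir s) = r * cos (t - s).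
Proof. unfold dot, polar, dir; simpl. rewrite cos_minus. ring. Qed.

Lemma cross_dir_polar r t s : cross (dir s) (polar r t) = r * sin (t - s).
Proof. unfold cross, polar, dir; simpl. rewrite sin_minus. ring. Qed.

Section Ratio.
Variable th : R.
Hypothesis (Hth : 0 < th <= 2 * PI / 7).

(** Amounts to [3 th / 4 < PI / 2 - th / 2], that is [th < 2 PI / 5], which seven cones already
    guarantee. *)
Lemma ratio_denominator_pos : 0 < cos (th / 2) - sin (3 * th / 4).
Proof.
  assert (Hpi := PI_RGT_0). rewrite <- sin_shift.
  apply Rlt_0_minus, sin_increasing_1; lra.
Qed.

Lemma ratio_ge_1 : 1 <= ratio th.
Proof.
  assert (Hpi := PI_RGT_0). assert (HD := ratio_denominator_pos).
  assert (cos (th / 2) <= cos (th / 4)) by (apply cos_decr_1; lra).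
  assert (0 <= sin (3 * th / 4)) by (apply sin_ge_0; lra).
  unfold ratio. apply Rmult_le_reg_r with (cos (th / 2) - sin (3 * th / 4)); [assumption|].
  field_simplify; lra.
Qed.

(* Sum-to-product form: [cos phi - sin (alpha - phi)] and [cos alpha] share the
   factor [2 sin (PI/4 - alpha/2)], which leaves a quotient of two cosines that is
   extremal at [alpha = th/4], [phi = - th/2]. *)
Lemma ratio_angle_le_ordered alpha phi :
  - (th / 4) <= alpha <= th / 4 -> - (th / 2) <= phi <= alpha ->
  cos alpha + ratio th * sin (alpha - phi) <= ratio th * cos phi.
Proof.
  intros Ha Hp. assert (Hpi := PI_RGT_0).
  assert (HD := ratio_denominator_pos).
  assert (Hfact : forall a p, cos p - sin (a - p) =
     2 * sin (PI / 4 - a / 2) * cos (PI / 4 + a / 2 - p)).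
  { intros a p. rewrite <- (sin_shift p), form4.
    replace ((PI / 2 - p - (a - p)) / 2) with (PI / 4 - a / 2) by field.
    replace ((PI / 2 - p + (a - p)) / 2) with (PI / 4 + a / 2 - p) by field. ring. }
  assert (Hcos : forall a, cos a = 2 * sin (PI / 4 - a / 2) * cos (PI / 4 - a / 2)).
  { intro a. rewrite <- sin_2a, <- sin_shift. f_equal. field. }
  assert (HD' : cos (th / 2) - sin (3 * th / 4) =
     2 * sin (PI / 4 - th / 4 / 2) * cos (PI / 4 + th / 4 / 2 + th / 2)).
  { replace (cos (th / 2)) with (cos (- (th / 2))) by apply cos_neg.
    replace (3 * th / 4) with (th / 4 - - (th / 2)) by field.
    rewrite Hfact. do 2 f_equal. ring. }
  (* The order [phi <= alpha] keeps the smaller angle nonnegative, where cosine decreases. *)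
  assert (HC : cos (PI / 4 + th / 4 / 2 + th / 2) <= cos (PI / 4 + alpha / 2 - phi))
    by (apply cos_decr_1; lra).
  assert (HA : cos (PI / 4 - alpha / 2) <= cos (PI / 4 - th / 4 / 2))
    by (apply cos_decr_1; lra).
  assert (HS : 0 <= sin (PI / 4 - alpha / 2)) by (apply sin_ge_0; lra).
  assert (HS0 : 0 <= sin (PI / 4 - th / 4 / 2)) by (apply sin_ge_0; lra).
  assert (HC0 : 0 <= cos (PI / 4 + th / 4 / 2 + th / 2)) by (apply cos_ge_0; lra).
  assert (HA0 : 0 <= cos (PI / 4 - alpha / 2)) by (apply cos_ge_0; lra).
  assert (Hmain : cos alpha * (cos (th / 2) - sin (3 * th / 4)) <=
     cos (th / 4) * (cos phi - sin (alpha - phi))).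
  { rewrite HD', (Hfact alpha phi), (Hcos alpha), (Hcos (th / 4)).
    set (S := sin (PI / 4 - alpha / 2)) in *. set (S0 := sin (PI / 4 - th / 4 / 2)) in *.
    set (A := cos (PI / 4 - alpha / 2)) in *. set (A0 := cos (PI / 4 - th / 4 / 2)) in *.
    set (C := cos (PI / 4 + alpha / 2 - phi)) in *.
    set (C0 := cos (PI / 4 + th / 4 / 2 + th / 2)) in *.
    assert (A * C0 <= A0 * C) by (apply Rmult_le_compat; assumption).
    assert (0 <= S * S0) by (apply Rmult_le_pos; assumption).
    nra. }
  apply Rplus_le_reg_r with (- (ratio th * sin (alpha - phi))).
  replace (ratio th * cos phi + - (ratio th * sin (alpha - phi))) with
    (cos (th / 4) * (cos phi - sin (alpha - phi)) / (cos (th / 2) - sin (3 * th / 4)))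
    by (unfold ratio; field; lra).
  apply Rmult_le_reg_r with (cos (th / 2) - sin (3 * th / 4)); [assumption|].
  replace (cos (th / 4) * (cos phi - sin (alpha - phi)) / (cos (th / 2) - sin (3 * th / 4)) *
    (cos (th / 2) - sin (3 * th / 4))) with (cos (th / 4) * (cos phi - sin (alpha - phi)))
    by (field; lra).
  lra.
Qed.

(** Reflection in the bisector negates both angles and so reduces [alpha < phi] to the ordered
    case. *)
Lemma ratio_angle_le alpha phi :
  - (th / 4) <= alpha <= th / 4 -> - (th / 2) <= phi <= th / 2 ->
  cos alpha + ratio th * Rabs (sin (alpha - phi)) <= ratio th * cos phi.
Proof.
  intros Ha Hp. assert (Hpi := PI_RGT_0).
  destruct (Rle_lt_dec phi alpha) as [H|H].
  - rewrite Rabs_right; [apply ratio_angle_le_ordered; lra|].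
    apply Rle_ge, sin_ge_0; lra.
  - rewrite <- (cos_neg alpha), <- (cos_neg phi), <- Rabs_Ropp, <- sin_neg.
    replace (- (alpha - phi)) with (- alpha - - phi) by ring.
    rewrite Rabs_right; [apply ratio_angle_le_ordered; lra|].
    apply Rle_ge, sin_ge_0; lra.
Qed.

(** As [vy] is orthogonal to the bisector, trigonometry in the triangle [uvy] gives
    [|uy| = rho cos phi / cos alpha] and [|vy| = rho |sin (alpha - phi)| / cos alpha]. The claim is
    then [ratio_angle_le] multiplied by [rho / cos alpha]. *)
Lemma cone_detour_le u v w B r alpha rho phi :
  vsub w u = polar r (B + alpha) -> vsub v u = polar rho (B + phi) ->
  0 < r -> 0 < rho ->
  - (th / 4) <= alpha <= th / 4 -> - (th / 2) <= phi <= th / 2 ->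
  dot (vsub v u) (dir B) <= dot (vsub w u) (dir B) ->
  let y := seg_point u w (dot (vsub v u) (dir B) / dot (vsub w u) (dir B)) in
  dist u v + ratio th * (dist v y + dist y w) <= ratio th * dist u w.
Proof.
  intros Ew Ev Hr Hrho Ha Hp HL. assert (Hpi := PI_RGT_0).
  assert (Hc := ratio_ge_1). assert (Hmain := ratio_angle_le alpha phi Ha Hp).
  assert (Hca : 0 < cos alpha) by (apply cos_gt_0; lra).
  rewrite Ew, Ev, !dot_polar_dir in *.
  replace (B + alpha - B) with alpha in * by ring.
  replace (B + phi - B) with phi in * by ring.
  set (s := rho * cos phi / (r * cos alpha)) in *. intro y.
  assert (Hsr : s * r = rho * cos phi / cos alpha) by (unfold s; field; lra).
  assert (Hs : s <= 1).
  { apply Rmult_le_reg_r with (r * cos alpha); [nra|]. unfold s. field_simplify; lra. }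
  apply (f_equal fst) in Ew as Ew1. apply (f_equal snd) in Ew as Ew2.
  apply (f_equal fst) in Ev as Ev1. apply (f_equal snd) in Ev as Ev2.
  unfold vsub, polar in Ew1, Ew2, Ev1, Ev2; simpl in Ew1, Ew2, Ev1, Ev2.
  assert (Duv : dist u v = rho).
  { rewrite dist_sym, dist_norm, Ev. apply norm_polar; lra. }
  assert (Duw : dist u w = r).
  { rewrite dist_sym, dist_norm, Ew. apply norm_polar; lra. }
  assert (Dyw : dist y w = (1 - s) * r).
  { rewrite <- Duw, dist_sym, (dist_sym u), !dist_norm.
    rewrite (norm_scal (vsub w u) (vsub w y) (1 - s));
      [|unfold y, seg_point; simpl; ring..]. rewrite Rabs_right; lra. }
  assert (Dvy : dist v y = rho / cos alpha * Rabs (sin (alpha - phi))).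
  { rewrite dist_norm.
    rewrite (norm_scal (polar 1 (B - PI / 2)) (vsub v y) (rho / cos alpha * sin (alpha - phi))).
    - rewrite norm_polar by lra. rewrite Rabs_mult, (Rabs_right (rho / cos alpha)).
      + ring.
      + apply Rle_ge, Rlt_le, Rdiv_lt_0_compat; lra.
    - unfold y, seg_point, vsub, polar; simpl.
      replace (fst v) with (fst u + rho * cos (B + phi)) by lra. rewrite Ew1.
      replace (fst u + rho * cos (B + phi) - (fst u + s * (r * cos (B + alpha)))) with
        (rho * cos (B + phi) - s * r * cos (B + alpha)) by ring.
      rewrite Hsr, !cos_plus, cos_minus, sin_minus, cos_PI2, sin_PI2. field; lra.
    - unfold y, seg_point, vsub, polar; simpl.
      replace (snd v) with (snd u + rho * sin (B + phi)) by lra. rewrite Ew2.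
      replace (snd u + rho * sin (B + phi) - (snd u + s * (r * sin (B + alpha)))) with
        (rho * sin (B + phi) - s * r * sin (B + alpha)) by ring.
      rewrite Hsr, !sin_plus, !sin_minus, cos_PI2, sin_PI2. field; lra. }
  rewrite Duv, Duw, Dyw, Dvy.
  replace (ratio th * (rho / cos alpha * Rabs (sin (alpha - phi)) + (1 - s) * r)) with
    (rho / cos alpha * (ratio th * Rabs (sin (alpha - phi))) + ratio th * r
       - ratio th * (s * r)) by (field; lra).
  rewrite Hsr.
  assert (H : rho / cos alpha * (cos alpha + ratio th * Rabs (sin (alpha - phi))) <=
     rho / cos alpha * (ratio th * cos phi)).
  { apply Rmult_le_compat_l; [|assumption]. apply Rlt_le, Rdiv_lt_0_compat; lra. }
  replace (rho / cos alpha * (cos alpha + ratio th * Rabs (sin (alpha - phi)))) with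
    (rho + rho / cos alpha * (ratio th * Rabs (sin (alpha - phi)))) in H by (field; lra).
  replace (ratio th * (rho * cos phi / cos alpha)) with
    (rho / cos alpha * (ratio th * cos phi)) by (field; lra).
  lra.
Qed.

End Ratio.

(** * Cones *)

Lemma polar_form a : exists r t, 0 <= r /\ a = polar r t.
Proof.
  destruct (Req_dec (norm a) 0) as [H0|H0].
  - exists 0, 0. split; [lra|]. assert (H := norm_sqr a). rewrite H0 in H.
    assert (H1 := Rle_0_sqr (fst a)). assert (H2 := Rle_0_sqr (snd a)). unfold Rsqr in *.
    unfold polar. apply point_eq; simpl; rewrite Rmult_0_l; apply Rsqr_0_uniq; unfold Rsqr; nra.
  - assert (Hn : 0 < norm a) by (assert (H := norm_nonneg a); lra).
    assert (Hsq := norm_sqr a).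
    set (x := fst a / norm a). set (y := snd a / norm a).
    assert (Hxy : x * x + y * y = 1).
    { unfold x, y. replace 1 with (norm a ^ 2 / norm a ^ 2) by (field; lra).
      rewrite Hsq at 1. field. lra. }
    assert (Hx : -1 <= x <= 1) by nra.
    assert (Ex : norm a * x = fst a) by (unfold x; field; lra).
    assert (Ey : norm a * y = snd a) by (unfold y; field; lra).
    assert (Hy : sqrt (1 - x²) = Rabs y).
    { rewrite <- sqrt_Rsqr_abs. f_equal. unfold Rsqr. lra. }
    destruct (Rle_lt_dec 0 y) as [Hy0|Hy0].
    + exists (norm a), (acos x). split; [lra|]. unfold polar. apply point_eq; simpl.
      * rewrite cos_acos; lra.
      * rewrite sin_acos, Hy, Rabs_right; lra.
    + exists (norm a), (- acos x). split; [lra|]. unfold polar. apply point_eq; simpl.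
      * rewrite cos_neg, cos_acos; lra.
      * rewrite sin_neg, sin_acos, Hy, Rabs_left; lra.
Qed.

Lemma polar_period r t (m : Z) : polar r (t + 2 * IZR m * PI) = polar r t.
Proof.
  assert (H : forall k s, polar r (s + 2 * IZR (Z.of_nat k) * PI) = polar r s).
  { intros k s. unfold polar. rewrite <- INR_IZR_INZ, cos_period, sin_period. reflexivity. }
  destruct (Z_le_gt_dec 0 m) as [Hm|Hm].
  - rewrite <- (Z2Nat.id m Hm). apply H.
  - rewrite <- (H (Z.to_nat (- m)) (t + 2 * IZR m * PI)), Z2Nat.id, opp_IZR by lia.
    f_equal. ring.
Qed.

Lemma polar_opp r t : polar r (t - PI) = (- fst (polar r t), - snd (polar r t)).
Proof.
  unfold polar; simpl. rewrite cos_minus, sin_minus, cos_PI, sin_PI. f_equal; ring.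
Qed.

Lemma nearest_integer x : exists m : Z, - / 2 <= IZR m - x <= / 2.
Proof.
  exists (up (x - / 2)). destruct (archimed (x - / 2)). split; lra.
Qed.

(* As [n] is odd, half a turn is an odd multiple of [theta n / 2]; hence one of
   the two orientations of a segment is within [theta n / 4] of a bisector. *)
Lemma near_bisector n u w : Nat.Odd n -> u <> w ->
  exists i r a, (i < n)%nat /\ 0 < r /\ - (theta n / 4) <= a <= theta n / 4 /\
    (vsub w u = polar r (PI / 2 - INR i * theta n + a) \/
     vsub u w = polar r (PI / 2 - INR i * theta n + a)).
Proof.
  intros Hodd Huw.
  assert (Hn : (0 < n)%nat) by (destruct Hodd; lia).
  assert (HnR : 0 < INR n) by now apply lt_0_INR.
  assert (Hpi := PI_RGT_0).
  assert (Hth : 0 < theta n) by (apply Rdiv_lt_0_compat; lra).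
  assert (Hnth : INR n * theta n = 2 * PI) by (unfold theta; field; lra).
  destruct (polar_form (vsub w u)) as (r & t & Hr & E).
  assert (Hr0 : 0 < r).
  { assert (H := dist_pos w u (not_eq_sym Huw)).
    rewrite dist_norm, E, norm_polar in H; assumption. }
  (* Counts half-cones clockwise from the vertical: an even count is a bisector, an odd one a
     boundary ray. *)
  destruct (nearest_integer ((PI / 2 - t) / (theta n / 2))) as (j & Hj).
  set (a := IZR j * (theta n / 2) - (PI / 2 - t)).
  assert (Ha : - (theta n / 4) <= a <= theta n / 4).
  { assert (Ea : a = (IZR j - (PI / 2 - t) / (theta n / 2)) * (theta n / 2))
      by (unfold a; field; lra).
    rewrite Ea. split; nra. }
  assert (Hbis : forall m : Z, exists i, (i < n)%nat /\
     polar r (PI / 2 - IZR m * theta n + a) = polar r (PI / 2 - INR i * theta n + a)).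
  { intro m. exists (Z.to_nat (m mod Z.of_nat n)).
    assert (Hm := Z.mod_pos_bound m (Z.of_nat n) ltac:(lia)). split; [lia|].
    rewrite INR_IZR_INZ, Z2Nat.id by lia.
    rewrite <- (polar_period r _ (m / Z.of_nat n)). f_equal.
    assert (Em := f_equal IZR (Z.div_mod m (Z.of_nat n) ltac:(lia))).
    rewrite plus_IZR, mult_IZR, <- INR_IZR_INZ in Em. rewrite Em at 1.
    replace (2 * IZR (m / Z.of_nat n) * PI) with (IZR (m / Z.of_nat n) * (INR n * theta n))
      by (rewrite Hnth; ring).
    ring. }
  destruct (Z.Even_or_Odd j) as [[m Hm]|[m Hm]].
  - destruct (Hbis m) as (i & Hi & Ei). exists i, r, a. repeat split; try lra; auto.
    left. rewrite E, <- Ei. f_equal. unfold a. rewrite Hm, mult_IZR. field.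
  - destruct Hodd as [k Hk].
    (* With [n = 2k + 1], half a turn is [2k + 1] half-cones; added to [j = 2m + 1] it gives
       [2 (m + k + 1)], the bisector of index [m + k + 1] modulo [n]. *)
    destruct (Hbis (m + Z.of_nat k + 1)%Z) as (i & Hi & Ei).
    exists i, r, a. repeat split; try lra; auto.
    right. rewrite <- Ei.
    assert (Et : PI / 2 - IZR (m + Z.of_nat k + 1) * theta n + a = t - PI).
    { assert (Hpi2 : PI = (2 * INR k + 1) * theta n / 2).
      { assert (Hk' : INR n = 2 * INR k + 1)
          by (rewrite Hk, plus_INR, mult_INR; simpl; ring).
        rewrite Hk' in Hnth. lra. }
      unfold a. rewrite Hm, !plus_IZR, mult_IZR, <- INR_IZR_INZ.
      apply Rplus_eq_reg_r with (- t + PI). ring_simplify. rewrite Hpi2 at 1. field. }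
    rewrite Et, polar_opp, <- E. unfold vsub; simpl. f_equal; ring.
Qed.

Lemma cross_dir_shift B h q :
  cross (dir (B + h)) q = cos h * cross (dir B) q - sin h * dot q (dir B).
Proof.
  unfold cross, dot, dir; simpl. rewrite cos_plus, sin_plus. ring.
Qed.

Lemma cross_dir_shift_neg B h q :
  cross (dir (B - h)) q = cos h * cross (dir B) q + sin h * dot q (dir B).
Proof.
  unfold Rminus. rewrite cross_dir_shift, cos_neg, sin_neg. ring.
Qed.

Section Cones.
Variable n : nat.
Hypothesis (Hn : (7 <= n)%nat).

Lemma theta_bounds : 0 < theta n <= 2 * PI / 7.
Proof.
  assert (Hpi := PI_RGT_0). apply le_INR in Hn. simpl in Hn.
  unfold theta. split; [apply Rdiv_lt_0_compat; lra|].
  unfold Rdiv. apply Rmult_le_compat_l; [lra|]. apply Rinv_le_contravar; lra.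
Qed.

Lemma in_cone_polar i u r a : 0 < r -> - (theta n / 4) <= a <= theta n / 4 ->
  forall w, vsub w u = polar r (PI / 2 - INR i * theta n + a) -> in_cone n i u w.
Proof.
  intros Hr Ha w E. assert (Hpi := PI_RGT_0). assert (Hth := theta_bounds).
  unfold in_cone, lbd, rbd. rewrite E, !cross_dir_polar. split.
  - set (t := PI / 2 - INR i * theta n).
    replace (t + a - (t + theta n / 2)) with (- (theta n / 2 - a)) by ring.
    rewrite sin_neg. assert (0 <= sin (theta n / 2 - a)) by (apply sin_ge_0; lra). nra.
  - apply Rmult_lt_0_compat; [assumption|]. apply sin_gt_0; lra.
Qed.

(** Subtracting the two boundary inequalities cancels the component across the bisector and leaves
    [2 sin (theta n / 2)] times the projection. *)
Lemma in_cone_dot_pos i u w : in_cone n i u w -> 0 < dot (vsub w u) (bis n i).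
Proof.
  intros [H1 H2]. assert (Hpi := PI_RGT_0). assert (Hth := theta_bounds).
  unfold lbd, rbd in *. rewrite cross_dir_shift in H1. rewrite cross_dir_shift_neg in H2.
  assert (0 < sin (theta n / 2)) by (apply sin_gt_0; lra).
  unfold bis. nra.
Qed.

Lemma in_cone_angle i u w : in_cone n i u w ->
  exists rho phi, 0 < rho /\ - (theta n / 2) <= phi <= theta n / 2 /\
    vsub w u = polar rho (PI / 2 - INR i * theta n + phi).
Proof.
  intro Hw. assert (HL := in_cone_dot_pos _ _ _ Hw). destruct Hw as [H1 H2].
  assert (Hpi := PI_RGT_0). assert (Hth := theta_bounds).
  unfold lbd, rbd, bis in *. set (B := PI / 2 - INR i * theta n) in *.
  set (q := vsub w u) in *. clearbody q.
  (* The projection is positive, so the arctangent is the angle from the bisector, without a choice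
     of branch. *)
  set (phi := atan (cross (dir B) q / dot q (dir B))).
  assert (Hphi : - PI / 2 < phi < PI / 2) by apply atan_bound.
  assert (Hc : 0 < cos phi) by (apply cos_gt_0; lra).
  assert (Htan : sin phi / cos phi = cross (dir B) q / dot q (dir B)) by apply tan_atan.
  set (rho := dot q (dir B) / cos phi).
  assert (Hrho : 0 < rho) by now apply Rdiv_lt_0_compat.
  assert (D1 : rho * cos phi = dot q (dir B)) by (unfold rho; field; lra).
  assert (D2 : rho * sin phi = cross (dir B) q).
  { replace (rho * sin phi) with (dot q (dir B) * (sin phi / cos phi))
      by (unfold rho; field; lra). rewrite Htan. field. lra. }
  assert (E : q = polar rho (B + phi)).
  { assert (Hs := sin2_cos2 B). unfold Rsqr in Hs.
    unfold polar. rewrite cos_plus, sin_plus. apply point_eq; simpl.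
    - replace (rho * (cos B * cos phi - sin B * sin phi)) with
        (cos B * (rho * cos phi) - sin B * (rho * sin phi)) by ring.
      rewrite D1, D2. unfold cross, dot, dir; simpl.
      transitivity (fst q * (sin B * sin B + cos B * cos B)); [rewrite Hs|]; ring.
    - replace (rho * (sin B * cos phi + cos B * sin phi)) with
        (sin B * (rho * cos phi) + cos B * (rho * sin phi)) by ring.
      rewrite D1, D2. unfold cross, dot, dir; simpl.
      transitivity (snd q * (sin B * sin B + cos B * cos B)); [rewrite Hs|]; ring. }
  exists rho, phi. split; [assumption|split; [|assumption]].
  rewrite E, cross_dir_polar in H1, H2. split; apply Rnot_lt_le; intro H.
  - assert (0 < sin (- (B + phi - (B - theta n / 2)))) by (apply sin_gt_0; lra).
    rewrite sin_neg in *. nra.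
  - assert (0 < sin (B + phi - (B + theta n / 2))) by (apply sin_gt_0; lra). nra.
Qed.

(** * Rays and subcones within a cone *)

Lemma sub_ray_dot_pos S i u r : sub_ray S n i u r -> 0 < dot r (bis n i).
Proof.
  assert (Hpi := PI_RGT_0). assert (Hth := theta_bounds).
  assert (Hcos : 0 < cos (theta n / 2)) by (apply cos_gt_0; lra).
  assert (Hdir : forall t, dot (dir t) (bis n i) = cos (t - (PI / 2 - INR i * theta n))).
  { intro t. unfold dot, bis, dir; simpl. rewrite (cos_minus t). ring. }
  intros [->|[->|(c & _ & Hc & ->)]]; [| |now apply in_cone_dot_pos].
  - unfold lbd. rewrite Hdir.
    match goal with |- 0 < cos ?x => replace x with (theta n / 2) by ring end. assumption.
  - unfold rbd. rewrite Hdir.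
    match goal with |- 0 < cos ?x => replace x with (- (theta n / 2)) by ring end.
    now rewrite cos_neg.
Qed.

(** The tangent of the counterclockwise angle from the bisector. On vectors of positive projection
    it turns the sign of [cross] into a comparison of reals, so that extremal rays can be chosen. *)
Definition slope (i : nat) (r : point) : R := cross (bis n i) r / dot r (bis n i).

Lemma cross_slope i a b : 0 < dot a (bis n i) -> 0 < dot b (bis n i) ->
  cross a b = dot a (bis n i) * dot b (bis n i) * (slope i b - slope i a).
Proof.
  intros Ha Hb. assert (H := cross_dot_frame (bis n i) a b).
  assert (Hs := sin2_cos2 (PI / 2 - INR i * theta n)). unfold Rsqr in Hs.
  replace (fst (bis n i) ^ 2 + snd (bis n i) ^ 2) with 1 in H
    by (rewrite <- Hs; unfold bis, dir; simpl; ring).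
  rewrite Rmult_1_l in H. rewrite H. unfold slope.
  replace (dot (bis n i) a) with (dot a (bis n i)) by (unfold dot; ring).
  replace (dot (bis n i) b) with (dot b (bis n i)) by (unfold dot; ring).
  field. lra.
Qed.

(** [a] is the ray of least slope not below [w], and [b] the ray of greatest slope below [a]; they
    are adjacent by construction. *)
Lemma subcone_exists S i u w : in_cone n i u w ->
  exists a b, subcone S n i u a b /\ in_subcone n i u a b w.
Proof.
  intro Hw. assert (HL := in_cone_dot_pos _ _ _ Hw).
  set (rays := lbd n i :: rbd n i ::
    map (fun c => vsub c u) (map fst S ++ map snd S)).
  assert (Hrays : forall r, sub_ray S n i u r -> In r rays).
  { intros r [->|[->|(c & Hc & _ & ->)]]; [now left|now right; left|].
    right; right. apply in_map_iff. exists c. split; [reflexivity|].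
    apply in_app_iff. destruct Hc as [Hc|Hc]; [right|left];
      apply in_map_iff; [now exists (u, c)|now exists (c, u)]. }
  assert (Hl : sub_ray S n i u (lbd n i)) by now left.
  assert (Hr : sub_ray S n i u (rbd n i)) by now right; left.
  assert (Hpos := sub_ray_dot_pos S i u).
  assert (Hcmp : forall a b, 0 < dot a (bis n i) -> 0 < dot b (bis n i) ->
     (cross a b < 0 <-> slope i b < slope i a)).
  { intros a b Ha Hb. rewrite (cross_slope i a b Ha Hb).
    assert (0 < dot a (bis n i) * dot b (bis n i)) by now apply Rmult_lt_0_compat.
    split; nra. }
  destruct Hw as [W1 W2].
  destruct (list_argmin _ (slope i)
    (fun r => sub_ray S n i u r /\ slope i (vsub w u) <= slope i r) rays)
    as (a & _ & [Ra Ha] & Hamin).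
  { exists (lbd n i). split; [now left|split; [assumption|]].
    apply Rnot_lt_le. intro H. apply (Hcmp (vsub w u) (lbd n i)) in H; auto.
    rewrite cross_swap in H. lra. }
  assert (Hwr : slope i (rbd n i) < slope i (vsub w u)).
  { apply Hcmp; auto. rewrite cross_swap. lra. }
  (* Comparing with [a] rather than with [w] matters when [w] lies on a constraint ray; that [b] is
     not above [w] then follows from the choice of [a]. *)
  destruct (list_argmin _ (fun r => - slope i r)
    (fun r => sub_ray S n i u r /\ slope i r < slope i a) rays)
    as (b & _ & [Rb Hb] & Hbmin).
  { exists (rbd n i). split; [now right; left|split; [assumption|lra]]. }
  assert (Hbw : slope i b <= slope i (vsub w u)).
  { apply Rnot_lt_le. intro H.
    specialize (Hamin b (Hrays b Rb) (conj Rb (Rlt_le _ _ H))). lra. }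
  exists a, b. split.
  - split; [assumption|split; [assumption|split; [apply Hcmp; auto|]]].
    intros r Rr [H1 H2]. apply Hcmp in H1, H2; auto.
    specialize (Hbmin r (Hrays r Rr) (conj Rr H1)). lra.
  - split; [now split|split; apply Rnot_lt_le; intro H].
    + assert (H' : cross (vsub w u) a < 0) by (rewrite cross_swap; lra).
      apply Hcmp in H'; auto. lra.
    + apply Hcmp in H; auto. lra.
Qed.

Lemma in_subcone_comb i u a b v w x y :
  0 < x -> 0 < y -> in_subcone n i u a b v -> in_subcone n i u a b w ->
  in_subcone n i u a b (comb u v w x y).
Proof.
  intros Hx Hy ((V1 & V2) & V3 & V4) ((W1 & W2) & W3 & W4).
  unfold in_subcone, in_cone. rewrite !cross_comb. repeat split; nra.
Qed.

(** A constraint inside the angle [vuw] would give a ray strictly between the adjacent rays [a] and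
    [b]. *)
Lemma subcone_no_spoke S i u a b v w :
  subcone S n i u a b -> in_subcone n i u a b v -> in_subcone n i u a b w ->
  cross (vsub v u) (vsub w u) <> 0 -> no_spoke S u v w.
Proof.
  intros (Ra & Rb & Hab & Hbetween) Hv Hw HD c x y Hc Hx Hy E.
  assert (Hcone := in_subcone_comb i u a b v w x y Hx Hy Hv Hw). rewrite <- E in Hcone.
  apply (Hbetween (vsub c u)); [right; right; exists c; repeat split; apply Hc || apply Hcone|].
  assert (Lv := in_cone_dot_pos _ _ _ (proj1 Hv)).
  assert (Lw := in_cone_dot_pos _ _ _ (proj1 Hw)).
  destruct Hv as (_ & V3 & V4), Hw as (_ & W3 & W4).
  (* Strictness: [v] and [w] cannot both lie on one bounding ray, as they are not collinear with
     [u]. *)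
  assert (Hstrict : forall r, sub_ray S n i u r ->
     cross r (vsub v u) = 0 -> cross r (vsub w u) = 0 -> False).
  { intros r Rr H1 H2. apply sub_ray_dot_pos in Rr. apply HD.
    apply Rmult_eq_reg_l with (dot r (bis n i)); [|lra].
    rewrite Rmult_0_r.
    transitivity (dot (vsub v u) (bis n i) * cross r (vsub w u) -
      dot (vsub w u) (bis n i) * cross r (vsub v u)); [unfold cross, dot; ring|].
    rewrite H1, H2. ring. }
  split.
  - rewrite E, cross_comb. destruct (Rle_lt_or_eq_dec _ _ V3) as [H|H]; [nra|].
    destruct (Rle_lt_or_eq_dec _ _ W3) as [H'|H']; [nra|].
    exfalso. exact (Hstrict a Ra H H').
  - rewrite cross_swap, E, cross_comb. destruct (Rle_lt_or_eq_dec _ _ V4) as [H|H]; [nra|].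
    destruct (Rle_lt_or_eq_dec _ _ W4) as [H'|H']; [nra|].
    exfalso. exact (Hstrict b Rb (eq_sym H) (eq_sym H')).
Qed.

(** * Paths in the theta-graph *)

Lemma theta_edge_sym P S u v : theta_edge P S n u v -> theta_edge P S n v u.
Proof. unfold theta_edge; tauto. Qed.

Lemma theta_edge_vis P S u v : theta_edge P S n u v -> vis_edge P S u v.
Proof.
  assert (H : forall a b, In a P -> theta_choice P S n a b -> vis_edge P S a b).
  { intros a b Ha (i & x & y & _ & _ & Hb & (Hc & _) & Hs & _).
    repeat split; auto. intros <-. apply in_cone_dot_pos in Hc.
    unfold dot, vsub in Hc; simpl in Hc. lra. }
  intros (Hu & Hv & [Hc|Hc]); auto using vis_edge_sym.
Qed.

(** The inductive step for a well-oriented pair: one theta-edge followed by visibility edges, where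
    only the latter are charged the factor [ratio]. *)
Lemma theta_step P S i u w r a :
  valid_constraints P S -> no_three_collinear P -> vis_edge P S u w -> (i < n)%nat ->
  0 < r -> - (theta n / 4) <= a <= theta n / 4 ->
  vsub w u = polar r (PI / 2 - INR i * theta n + a) ->
  exists v l, theta_edge P S n u v /\ u <> v /\ chain (vis_edge P S) v l /\ last l v = w /\
    dist u v + ratio (theta n) * wlen v l <= ratio (theta n) * dist u w.
Proof.
  intros Hvalid Hcol (Pu & Pw & Nuw & Suw) Hi Hr Ha E.
  assert (Hth := theta_bounds). assert (Hc1 := ratio_ge_1 _ Hth).
  assert (Cw := in_cone_polar i u r a Hr Ha w E).
  destruct (subcone_exists S i u w Cw) as (ra & rb & Hsub & Hw).
  destruct (list_argmin _ (fun v => dot (vsub v u) (bis n i))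
    (fun v => in_subcone n i u ra rb v /\ can_see S u v) P)
    as (v & Pv & [Hv Sv] & Hmin).
  { now exists w. }
  assert (Lv := in_cone_dot_pos _ _ _ (proj1 Hv)).
  assert (Nuv : u <> v).
  { intros <-. unfold dot, vsub in Lv; simpl in Lv; lra. }
  assert (Hedge : theta_edge P S n u v).
  { split; [assumption|split; [assumption|left]]. exists i, ra, rb.
    repeat split; try apply Hsub; try apply Hv; auto. }
  destruct (classic (v = w)) as [->|Nvw].
  - exists w, nil. do 4 (split; [easy|]). simpl. rewrite Rmult_0_r, Rplus_0_r.
    assert (H := Rmult_le_compat_r _ _ _ (dist_nonneg u w) Hc1). lra.
  - assert (HD : cross (vsub v u) (vsub w u) <> 0) by (apply Hcol; auto).
    assert (W : wedge P S u v w).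
    { repeat split; auto. now apply (subcone_no_spoke S i u ra rb). }
    assert (HLvw := Hmin w Pw (conj Hw Suw)).
    destruct (visibility_path_below P S Hvalid Hcol u w (bis n i) v) as (l & Hl & Hlast & Hlen);
      auto.
    (* By convexity the triangle lies in the subcone of [v] and [w], so the minimality of [v] bounds
       its visible points. *)
    + intros p Pp Sp (x & y & Hx & Hy & _ & Ep). apply Hmin; auto. split; auto.
      rewrite Ep. now apply in_subcone_comb.
    + exists v, l. do 4 (split; [assumption|]).
      destruct (in_cone_angle i u v (proj1 Hv)) as (rho & phi & Hrho & Hphi & Ev).
      assert (Hdet := cone_detour_le (theta n) Hth u v w (PI / 2 - INR i * theta n)
        r a rho phi E Ev Hr Hrho Ha Hphi HLvw). cbv zeta in Hdet.
      apply Rle_trans with (2 := Hdet).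
      apply Rplus_le_compat_l, Rmult_le_compat_l; [lra|exact Hlen].
Qed.

Lemma theta_linked P S :
  Nat.Odd n -> valid_constraints P S -> no_three_collinear P ->
  forall u w, vis_edge P S u w -> linked (theta_edge P S n) u w (ratio (theta n) * dist u w).
Proof.
  intros Hodd Hvalid Hcol.
  assert (Hc1 := ratio_ge_1 _ theta_bounds).
  enough (H : forall uw : point * point, In uw (list_prod P P) ->
    vis_edge P S (fst uw) (snd uw) ->
    linked (theta_edge P S n) (fst uw) (snd uw) (ratio (theta n) * dist (fst uw) (snd uw))).
  { intros u w Huw. apply (H (u, w)); [|assumption].
    apply in_prod; apply Huw. }
  intros uw Puw. pattern uw. revert uw Puw.
  apply (list_real_induction _ (fun uw : point * point => dist (fst uw) (snd uw))).
  intros [u w] Puw IH Huw. simpl in *.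
  (* Stated for any pair at the same distance, so that it serves both orientations of [uw]. *)
  assert (Hstep : forall p q, vis_edge P S p q -> dist p q = dist u w ->
     forall i r a, (i < n)%nat -> 0 < r -> - (theta n / 4) <= a <= theta n / 4 ->
     vsub q p = polar r (PI / 2 - INR i * theta n + a) ->
     linked (theta_edge P S n) p q (ratio (theta n) * dist u w)).
  { intros p q Hpq Ed i r a Hi Hr Ha E.
    destruct (theta_step P S i p q r a) as (v & l & Hedge & Npv & Hl & Hlast & Hlen); auto.
    rewrite Ed in Hlen.
    apply linked_le with (dist p v + ratio (theta n) * wlen v l); [|assumption].
    rewrite <- Hlast. apply linked_trans with v; [now apply linked_edge|].
    apply (chain_dilation (vis_edge P S) (theta_edge P S n) _ (wlen v l)); auto; [|lra].
    intros x y Hxy Hle. apply (IH (x, y)); [apply in_prod; apply Hxy|simpl|exact Hxy].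
    (* The first edge has positive length, so the visibility path from [v], and with it each of its
       edges, is strictly shorter than [uw]. *)
    assert (H := dist_pos p v Npv). nra. }
  destruct (near_bisector n u w Hodd) as (i & r & a & Hi & Hr & Ha & [E|E]); [apply Huw|..].
  - eapply Hstep; eauto.
  - apply linked_sym; [now apply theta_edge_sym|].
    eapply Hstep; eauto using vis_edge_sym, dist_sym.
Qed.

End Cones.

Theorem theorem6 (k x : nat) (P : list point) (S : list (point * point)) :
  (1 <= k)%nat -> (x = 3 \/ x = 5)%nat ->
  general_position (4 * k + x) P ->
  valid_constraints P S ->
  t_spanner P (theta_edge P S (4 * k + x)) (vis_edge P S)
    (cos (theta (4 * k + x) / 4) /
     (cos (theta (4 * k + x) / 2) - sin (3 * theta (4 * k + x) / 4))).
Proof.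
  intros Hk Hx [_ Hcol] Hvalid. set (n := (4 * k + x)%nat).
  assert (Hn : (7 <= n)%nat) by lia.
  assert (Hodd : Nat.Odd n).
  { destruct Hx as [->| ->]; [exists (2 * k + 1)%nat|exists (2 * k + 2)%nat]; lia. }
  assert (Hth := theta_bounds n Hn). assert (Hc := ratio_ge_1 _ Hth).
  fold (ratio (theta n)). split; [intros u v; now apply theta_edge_vis|].
  intros u v Pu Pv dG [(l & Hl & <- & <-) _].
  apply (shortest_exists _ P); [intros a b Hab; apply Hab|].
  (* Each edge of a shortest visibility path is replaced by a theta-path; the cap is the length of
     the whole path. *)
  apply (chain_dilation (vis_edge P S) _ _ (wlen u l)); auto; [|lra].
  intros a b Hab _. now apply theta_linked.
Qed.
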